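(* Let $(\omega_k^{j})_{k\ge 1,\ 1\le j\le 4^{k-1}}$ be independent random variables, each uniformly distributed on $[0,\frac{\pi}{2}]$, and write $\omega_k'=(\omega_k^1,\dots,\omega_k^{4^{k-1}})$. For $n\in\mathbb{N}$ let $\mathcal{D}_n(\omega_1'\cdots\omega_n')$ be the union of $4^n$ disks of radius $4^{-n}$ associated with the $4$-ary tree of angles $\omega_1'\cdots\omega_n'$ of height $n$. Then there exists a constant $c>0$ such that for every $\theta\in[0,\frac{\pi}{2}]$ $$\mathbb{E}_{\omega_1'\cdots\omega_n'}\left|\operatorname{proj}_\theta \mathcal{D}_n(\omega_1'\cdots\omega_n')\right|\le\frac{c}{n}\qquad\text{for all } n\in\mathbb{N}.$$ Consequently, $$\mathbb{E}_{\omega_1'\cdots\omega_n'}\left[\operatorname{Fav}(\mathcal{D}_n(\omega_1'\cdots\omega_n'))\right]\le\frac{c}{n}\qquad\text{for all } n\in\mathbb{N},$$ and also, almost surely, $$\liminf_{n\to\infty}\, n\,\operatorname{Fav}(\mathcal{D}_n(\omega_1'\cdots\omega_n'))<\infty .$$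
   Context: Identify the plane with $\mathbb{C}$, and let $\mathbb{D}$ be the closed unit disk. **Trees of angles.** A tree of angles of height $n$ is a family $\omega_k^{j}\in[0,\frac{\pi}{2}]$ with $1\le k\le n$ and $1\le j\le 4^{k-1}$; $k$ is called the depth. The root is $\omega_1^1$, and the four children of the vertex $\omega_k^j$ are $\omega_{k+1}^{4j-3+\alpha}$, $\alpha=0,1,2,3$. The tree is denoted $\omega_1'\cdots\omega_n'$ with $\omega_k'=(\omega_k^1,\dots,\omega_k^{4^{k-1}})$. **The sets $\mathcal{D}_k$.** For a tree of angles, define enumerated disks inductively. Depth $0$: the single disk $\mathbb{D}$, regarded as disk number $1$, with centre $z_0^1=0$. Given the centres $z_{k-1}^{j}$ ($1\le j\le 4^{k-1}$) of the disks of depth $k-1$, the $j$-th disk of depth $k-1$ is replaced by four disks of radius $4^{-k}$, which are the disks number $4j-3+\alpha$ of depth $k$ ($\alpha=0,1,2,3$), with centres $$z_k^{4j-3+\alpha}=z_{k-1}^{j}+\frac{3}{4^{k}}\,e^{i(\alpha\frac{\pi}{2}-\omega_k^{j})}.$$ Then $\mathcal{D}_0=\mathbb{D}$, and $\mathcal{D}_k(\omega_1'\cdots\omega_k')\subset\mathbb{C}$ is the union of the $4^k$ closed disks of radius $4^{-k}$ with centres $z_k^1,\dots,z_k^{4^k}$. It satisfies $\mathcal{D}_k(\omega_1'\cdots\omega_k')\subset\mathcal{D}_{k-1}(\omega_1'\cdots\omega_{k-1}')$. **Projections and Favard length.** For $E\subset\mathbb{C}$, $\operatorname{proj}_\theta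 E$ is the orthogonal projection of $E$ onto the line through the origin forming angle $\theta$ with the horizontal axis, and $|A|$ is the one-dimensional Lebesgue measure of $A$. The Favard length is $$\operatorname{Fav}(E)=\frac{1}{\pi}\int_0^\pi\left|\operatorname{proj}_\theta E\right|\,d\theta .$$ $\mathbb{E}_{\omega_1'\cdots\omega_n'}$ denotes expectation over all angles of depth $1,\dots,n$. *)

(* Defs.v *)
From HB Require Import structures.
From mathcomp Require Import all_boot all_order all_algebra finmap.
From mathcomp Require Import all_classical all_reals all_analysis.
From mathcomp Require Import complex.

Set Implicit Arguments.
Unset Strict Implicit.
Unset Printing Implicit Defensive.

Import Order.TTheory GRing.Theory Num.Theory.
Import numFieldNormedType.Exports.

Local Open Scope classical_set_scope.
Local Open Scope ring_scope.
Local Open Scope complex_scope.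

Definition expi (R : realType) (t : R) : R[i] := cos t +i* sin t.

(* Vertices are numbered from 1, both in depth and inside each depth. *)
Definition tree_vertex (v : nat * nat) : bool :=
  [&& (1 <= v.1)%N, (1 <= v.2)%N & (v.2 <= 4 ^ (v.1 - 1))%N].

(* An infinite tree of angles is a function [w : nat -> nat -> R] with
   [w k j] the angle at the vertex (k, j); only its values on [tree_vertex]
   matter.  For m = 4j - 3 + alpha with 1 <= j and alpha < 4, one has
   j = (m - 1) %/ 4 + 1 and alpha = (m - 1) %% 4; see [centreS]. *)
Fixpoint centre (R : realType) (w : nat -> nat -> R) (k m : nat) : R[i] :=
  if k is k'.+1 then
    let j := ((m - 1) %/ 4 + 1)%N in
    let alpha := ((m - 1) %% 4)%N in
    centre w k' j
      + (3 / 4 ^+ k)%:C * expi (alpha%:R * (pi / 2) - w k j)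
  else 0.

Lemma centreS (R : realType) (w : nat -> nat -> R) (k j alpha : nat) :
  (1 <= j)%N -> (alpha < 4)%N ->
  centre w k.+1 (4 * j - 3 + alpha) =
  centre w k j + (3 / 4 ^+ k.+1)%:C * expi (alpha%:R * (pi / 2) - w k.+1 j).
Proof.
case: j => // j _ alpha4.
have -> : (4 * j.+1 - 3 + alpha = (j * 4 + alpha).+1)%N.
  by rewrite mulnS mulnC -addnBAC// addSn add0n addSn.
by rewrite /= subn1 /= divnMDl// divn_small// addn0 modnMDl modn_small// addn1.
Qed.

Definition disk (R : realType) (c : R[i]) (r : R) : set R[i] :=
  [set z | `|z - c| <= r%:C].

Definition disks (R : realType) (w : nat -> nat -> R) (n : nat) : set R[i] :=
  \bigcup_(m in [set m : nat | (1 <= m <= 4 ^ n)%N])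
    disk (centre w n m) (4 ^- n).

(* Orthogonal projection onto the line [R e^{i theta}]. *)
Definition orth_proj (R : realType) (theta : R) (E : set R[i]) : set R[i] :=
  [set (complex.Re z * cos theta + complex.Im z * sin theta)%:C * expi theta | z in E].

(* One-dimensional Lebesgue measure on the line [R e^{i theta}], transported
   by the isometry t |-> t e^{i theta}. *)
Definition line_measure (R : realType) (theta : R) (A : set R[i]) : \bar R :=
  lebesgue_measure [set t : R | A (t%:C * expi theta)].

Definition Fav (R : realType) (E : set R[i]) : \bar R :=
  ((pi^-1)%:E *
   \int[lebesgue_measure]_(theta in `[0%R, pi])
     line_measure theta (orth_proj theta E))%E.

Definition mutually_independent (d : measure_display) (T : measurableType d)
    (R : realType) (P : probability T R) (I : choiceType) (D : set I)
    (X : I -> {RV P >-> R}) : Prop :=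
  forall (J : {fset I}) (B : I -> set R),
    (forall i, i \in J -> D i) ->
    (forall i, i \in J -> measurable (B i)) ->
    P (\bigcap_(i in [set` J]) (X i @^-1` B i)) =
    (\prod_(i <- J) P (X i @^-1` B i))%E.

Lemma pi2_gt0 (R : realType) : 0 < pi / 2 :> R.
Proof. by rewrite divr_gt0// pi_gt0. Qed.

(* Main.v *)
(* Fix a direction theta.  Given the angle at the root, the projection of the
   random set is the union of four independent copies, contracted by 4, of the
   projection one level down.  So the probability that a point s is hit obeys a
   recursion, in which theta disappears because the four children are permuted
   when the root angle is shifted by pi/2.  Let F bound the hitting probability
   from above (starting from a continuous F >= 1_[-1,1]) and let m = int F.
   Inclusion-exclusion for the first two children gives m' <= m - overlap, and
   the overlap is 1/4 of the mean over phi of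
   int F(t) F(t + 3 (cos phi - sin phi)) dt.  The gap 3 (cos phi - sin phi)
   sweeps [-3, 3] with speed at most 6, which covers every difference of two
   points of the support of F, so the overlap is at least m^2 / (12 pi).
   Hence m' <= m - m^2 / (12 pi) and m_n <= 12 pi / n. *)

Require Import Defs.
From HB Require Import structures.
From mathcomp Require Import all_boot all_order all_algebra finmap.
From mathcomp Require Import all_classical all_reals all_analysis.
From mathcomp Require Import complex measurable_realfun.
From mathcomp Require Import ring lra zify.

Set Implicit Arguments.
Unset Strict Implicit.
Unset Printing Implicit Defensive.

Import Order.TTheory GRing.Theory Num.Theory.
Import numFieldNormedType.Exports.

Local Open Scope classical_set_scope.
Local Open Scope ring_scope.

(** * Independence of the sigma-algebras generated by disjoint blocks *)

Section independence.
Context (R : realType) (d : measure_display) (T : measurableType d)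
  (P : probability T R) (I : choiceType) (D : set I) (X : I -> {RV P >-> R}).
Context (X_indep : mutually_independent D X).

(** These events form a pi-system that generates the sigma-algebra [<<s cylinder V >>] of the
    coordinates in [V]; independence is first checked on them. *)
Definition cylinder (V : set I) : set (set T) :=
  [set E | exists (J : {fset I}) (B : I -> set R),
    [/\ [set` J] `<=` V, forall i, measurable (B i) &
        E = \bigcap_(i in [set` J]) (X i @^-1` B i)]].

Lemma measurable_RV_preimage (i : I) (B : set R) :
  measurable B -> measurable (X i @^-1` B).
Proof. by move=> mB; rewrite -[_ @^-1` _]setTI; exact: measurable_funP. Qed.

Lemma cylinder_measurable (V : set I) : cylinder V `<=` measurable.
Proof.
move=> _ [J [B [_ mB ->]]]; apply: fin_bigcap_measurable => //.
by move=> i _; exact: measurable_RV_preimage.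
Qed.

Lemma cylinderT (V : set I) : cylinder V setT.
Proof.
exists fset0, (fun=> setT); split; [by move=> i /=; rewrite inE|by []|].
by apply/seteqP; split => // x _ i /=; rewrite inE.
Qed.

Lemma cylinder1 (V : set I) (i : I) (B : set R) :
  V i -> measurable B -> cylinder V (X i @^-1` B).
Proof.
move=> Vi mB; exists [fset i]%fset, (fun=> B); split => //.
  by move=> j /=; rewrite inE => /eqP ->.
apply/seteqP; split => [x Bx j /=|x]; first by rewrite inE => /eqP ->.
by apply; rewrite /= inE.
Qed.

Lemma cylinderS (V W : set I) : V `<=` W -> cylinder V `<=` cylinder W.
Proof.
move=> VW _ [J [B [JV mB ->]]]; exists J, B; split => //.
exact: subset_trans VW.
Qed.

Lemma cylinder_setI (V : set I) : setI_closed (cylinder V).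
Proof.
move=> _ _ [J [B [JV mB ->]]] [J' [B' [JV' mB' ->]]].
exists (J `|` J')%fset, (fun i => (if i \in J then B i else setT) `&`
  (if i \in J' then B' i else setT)); split.
- by move=> i /=; rewrite inE => /orP[]; [exact: JV|exact: JV'].
- by move=> i; apply: measurableI; case: ifP.
- apply/seteqP; split => [x [h h'] i /= _|x h].
    by split; case: ifP => // iJ; [exact: h|exact: h'].
  split => i /= iJ; have /= := h i; rewrite inE iJ ?orbT => /(_ isT) [] //.
Qed.

Lemma cylinder_indep (V W : set I) (A B : set T) :
  V `<=` D -> W `<=` D -> V `&` W = set0 ->
  cylinder V A -> cylinder W B -> P (A `&` B) = (P A * P B)%E.
Proof.
move=> VD WD VW0 [J [F [JV mF ->]]] [K [G [KW mG ->]]].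
have JK i : i \in J -> i \in K -> False.
  by move=> /JV Vi /KW Wi; have : (V `&` W) i by []; rewrite VW0.
pose H i := if i \in J then F i else G i.
have HF i : i \in J -> H i = F i by rewrite /H => ->.
have HG i : i \in K -> H i = G i.
  by rewrite /H => iK; case: ifPn => // /JK /(_ iK).
have mH i : measurable (H i) by rewrite /H; case: ifP.
have capU : \bigcap_(i in [set` (J `|` K)%fset]) (X i @^-1` H i) =
  \bigcap_(i in [set` J]) (X i @^-1` F i) `&`
  \bigcap_(i in [set` K]) (X i @^-1` G i).
  apply/seteqP; split => [x h|x [h h'] i /=].
    split => i /= iJ; have /= := h i; rewrite inE iJ ?orbT => /(_ isT).
      by rewrite HF.
    by rewrite HG.
  by rewrite inE => /orP[] ij; [rewrite HF//; exact: h|rewrite HG//; exact: h'].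
rewrite -capU X_indep//; last first.
  by move=> i; rewrite inE => /orP[/JV/VD|/KW/WD].
rewrite (big_fsetID _ (fun i => i \in J))/=.
rewrite [X in (X * _)%E](_ : _ = P (\bigcap_(i in [set` J]) (X i @^-1` F i))).
  rewrite [X in (_ * X)%E](_ : _ = P (\bigcap_(i in [set` K]) (X i @^-1` G i)))//.
  rewrite X_indep//; last by move=> i /KW/WD.
  rewrite (_ : [fset x | x in (J `|` K)%fset & x \notin J]%fset = K).
    by apply: eq_big_seq => i iK; rewrite HG.
  apply/fsetP => i; rewrite !inE /=; apply/andP/idP.
    by move=> [/orP[->//|//]].
  by move=> iK; rewrite iK orbT; split => //; apply/negP => /JK /(_ iK).
rewrite X_indep//; last by move=> i /JV/VD.
rewrite (_ : [fset x | x in (J `|` K)%fset & x \in J]%fset = J).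
  by apply: eq_big_seq => i iJ; rewrite HF.
by apply/fsetP => i; rewrite !inE /=; apply/andP/idP => [[]//|->].
Qed.

Lemma sigma_cylinder_measurable (V : set I) : <<s cylinder V >> `<=` measurable.
Proof.
by apply: smallest_sub; [exact: sigma_algebra_measurable|exact: cylinder_measurable].
Qed.

(** For fixed [B], both sides are finite measures in [A]. They agree on the pi-system [G], which
    contains the whole space, hence on the sigma-algebra it generates. *)
Let sigma_indep_gen (G : set (set T)) (B : set T) : measurable B ->
  setI_closed G -> G setT -> G `<=` measurable ->
  (forall A, G A -> P (A `&` B) = (P A * P B)%E) ->
  forall A, <<s G >> A -> P (A `&` B) = (P A * P B)%E.
Proof.
move=> mB GI GT Gm GB A GA.
have PBge0 : (0 <= fine (P B))%R by rewrite fine_ge0.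
have PBE : P B = (fine (P B))%:E by rewrite fineK// fin_num_measure.
pose m2 : {measure set T -> \bar R} := mscale (NngNum PBge0) P.
pose m1 : {measure set T -> \bar R} := mrestr P mB.
have E12 C : (m1 C = m2 C) <-> P (C `&` B) = (P C * P B)%E.
  by rewrite /m1 /m2 /= /mrestr /mscale /= -PBE muleC.
apply/E12; apply: (g_sigma_algebra_measure_unique G Gm (fun=> setT)) => //.
- by apply/seteqP; split => // x _; exists 0%N.
- by move=> C GC; apply/E12/GB.
- move=> _; rewrite /m1 /= /mrestr setTI (le_lt_trans (probability_le1 P mB))//.
  exact: ltry.
Qed.

(** The pi-system argument is used twice: it reduces [A] to a cylinder while [B] is arbitrary, then
    [B] to a cylinder while [A] is one. *)
Lemma sigma_cylinder_indep (V W : set I) (A B : set T) :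
  V `<=` D -> W `<=` D -> V `&` W = set0 ->
  <<s cylinder V >> A -> <<s cylinder W >> B -> P (A `&` B) = (P A * P B)%E.
Proof.
move=> VD WD VW0 VA WB.
apply: (sigma_indep_gen (sigma_cylinder_measurable WB) (@cylinder_setI V)
  (cylinderT V) (@cylinder_measurable V)) VA => {}A VA.
have mA := cylinder_measurable VA.
rewrite setIC muleC; apply: (sigma_indep_gen mA (@cylinder_setI W)
  (cylinderT W) (@cylinder_measurable W)) WB => {}B WB.
by rewrite setIC muleC; exact: (cylinder_indep VD WD VW0).
Qed.

Lemma sigma_cylinder_idfun (W : set I) :
  measurable_fun setT (fun x : T => x : g_sigma_algebraType (cylinder W)).
Proof. by move=> _ B mB; rewrite setTI; exact: sigma_cylinder_measurable mB. Qed.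

(** By induction: the first [n] events all belong to the sigma-algebra of the union of their blocks,
    and this union is disjoint from the last block. *)
Lemma sigma_cylinder_bigcap (n : nat) (V : nat -> set I) (A : nat -> set T) :
  (forall a, (a < n)%N -> V a `<=` D) ->
  (forall a b, (a < b < n)%N -> V a `&` V b = set0) ->
  (forall a, (a < n)%N -> <<s cylinder (V a) >> (A a)) ->
  P (\big[setI/setT]_(a < n) A a) = (\prod_(a < n) P (A a))%E.
Proof.
elim: n => [|n IH] VD Vdisj VA; first by rewrite !big_ord0 probability_setT.
rewrite !big_ord_recr /= -IH; last 3 first.
- by move=> a an; apply: VD; exact: ltnW.
- by move=> a b /andP[ab bn]; apply: Vdisj; rewrite ab ltnW.
- by move=> a an; apply: VA; exact: ltnW.
apply: (@sigma_cylinder_indep [set i | exists2 a, (a < n)%N & V a i] (V n)).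
- by move=> i [a an]; apply: VD; exact: ltnW.
- exact: VD.
- apply/seteqP; split => // i [[a an Vai] Vni].
  by have : (V a `&` V n) i by []; rewrite Vdisj// an ltnSn.
- apply: (@bigsetI_measurable _ (g_sigma_algebraType (cylinder _))) => a _.
  apply: sub_smallest2r (VA a (ltnW (ltn_ord a))); first exact: smallest_sigma_algebra.
  by apply: cylinderS => i Vai; exists a.
- exact: VA.
Qed.

(* [x] itself, observed through the coordinates in [W] only, is a random
   element independent of [X i] as soon as [i] is not in [W] *)
Lemma sigma_cylinder_joint_law (W : set I) (i : I)
    (Z : set (R * g_sigma_algebraType (cylinder W))) :
  W `<=` D -> D i -> ~ W i -> measurable Z ->
  measurable_fun setT (fun r => P [set x | Z (r, x)]) /\
  P [set x | Z (X i x, x)] =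
  (\int[distribution P (X i)]_r P [set x | Z (r, x)])%E.
Proof.
move=> WD Di Wi mZ.
pose S := g_sigma_algebraType (cylinder W).
pose Y : {mfun T >-> S} := HB.pack (fun x : T => x : S)
  (isMeasurableFun.Build _ _ _ _ _ (@sigma_cylinder_idfun W)).
have mXY : measurable_fun setT (fun x : T => (X i x, x : S)).
  apply: measurable_fun_pair; first exact: measurable_funP.
  exact: sigma_cylinder_idfun.
pose XY : {mfun T >-> (R * S)%type} := HB.pack (fun x : T => (X i x, x : S))
  (isMeasurableFun.Build _ _ _ _ _ mXY).
(* On rectangles the law of the pair is the product of the two laws. Uniqueness of the product
   measure then turns the probability of [Z] into an integral of sections. *)
have rectE A B : measurable A -> measurable B ->
    distribution P XY (A `*` B) =
    (distribution P (X i) A * distribution P Y B)%E.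
  move=> mA mB; rewrite /distribution /pushforward /=.
  rewrite -[RHS](@sigma_cylinder_indep [set i] W)//.
  - by move=> _ ->.
  - by apply/seteqP; split => // j [/= -> /Wi].
  - by apply: sub_sigma_algebra; exact: cylinder1.
have secE : (fun r => P [set x | Z (r, x)]) = distribution P Y \o xsection Z.
  apply/funext => r; rewrite /distribution /pushforward /=.
  by congr (P _); apply/seteqP; split => x /=; rewrite /xsection /= inE.
split; first by rewrite secE; exact: measurable_fun_xsection.
have -> : P [set x | Z (X i x, x)] = distribution P XY Z by [].
by rewrite -(product_measure_unique rectE)// /product_measure1 secE.
Qed.

End independence.

(** * Projections of the disks as shadows of subtrees *)

Section shadow.
Context (R : realType).
Implicit Types (w : nat -> nat -> R) (theta s t : R) (m k j : nat).

(* Position relative to its parent, magnified by [4 ^ (k + 1)] and projected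
   in direction [theta], of the child number [a] of a disk of depth [k]. *)
Definition offset (a : nat) (phi : R) : R := 3 * cos (a%:R * (pi / 2) - phi).

(* Projection in direction [theta], magnified by [4 ^ k], of the part of the
   construction of depth [k + m] contained in the disk number [j + 1] of depth
   [k], relative to the centre of this disk. *)
Fixpoint shadow w theta m k j : set R :=
  if m is m'.+1 then
    [set s | exists a : 'I_4, shadow w theta m' k.+1 (4 * j + a)
       (4 * s - offset a (w k.+1 j.+1 + theta))]
  else [set s | `|s| <= 1].

(** Disks are counted from 0 here but from 1 in [centre]; the children of [j] thereby become
    [4 * j + a]. *)
Definition centre_proj w theta k j : R :=
  complex.Re (centre w k j.+1) * cos theta
  + complex.Im (centre w k j.+1) * sin theta.

(** Projecting the displacement of angle [a * (pi / 2) - w] in direction [theta] leaves the cosine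
    of [a * (pi / 2) - (w + theta)]: the direction acts as a shift of the angle. *)
Lemma centre_projS w theta k j a : (a < 4)%N ->
  centre_proj w theta k.+1 (4 * j + a) =
  centre_proj w theta k j + offset a (w k.+1 j.+1 + theta) / 4 ^+ k.+1.
Proof.
move=> a4; rewrite /centre_proj.
have -> : ((4 * j + a).+1 = 4 * j.+1 - 3 + a)%N by lia.
rewrite centreS// /offset /expi opprD addrA; set p := a%:R * _ - _.
rewrite (cosB p theta); case: (centre w k j.+1) => x y; simpc => /=.
by field; rewrite expf_neq0.
Qed.

(** Induction on [m] with [k] free: one generation is moved from [m] to [k], and disks of depth
    [k + 1] are regrouped by parent. *)
Lemma shadow_disks w theta m k t :
  (exists2 j, (j < 4 ^ (k + m))%N &
     `|t - centre_proj w theta (k + m) j| <= 4 ^- (k + m)) <->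
  (exists2 j, (j < 4 ^ k)%N &
     shadow w theta m k j (4 ^+ k * (t - centre_proj w theta k j))).
Proof.
elim: m k => [|m IH] k.
  rewrite addn0; have e4 : 0 < 4 ^+ k :> R by rewrite exprn_gt0.
  suff H j : (`|t - centre_proj w theta k j| <= 4 ^- k) =
      (`|4 ^+ k * (t - centre_proj w theta k j)| <= 1).
    by split => -[j jk h]; exists j; rewrite /= ?H// -H.
  by rewrite normrM (gtr0_norm e4) -ler_pdivlMl// mulr1.
rewrite -addSnnS IH.
have E j a : (a < 4)%N ->
    4 ^+ k.+1 * (t - centre_proj w theta k.+1 (4 * j + a)) =
    4 * (4 ^+ k * (t - centre_proj w theta k j))
      - offset a (w k.+1 j.+1 + theta).
  by move=> a4; rewrite centre_projS// exprS; field; rewrite expf_neq0.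
split=> [[j jk sj]|[j jk [a sa]]].
  (* The disk [j] of depth [k + 1] is the child [j %% 4] of the disk [j %/ 4]. *)
  have j4 : (j %/ 4 < 4 ^ k)%N by rewrite ltn_divLR// mulnC -expnS.
  exists (j %/ 4)%N => //=; exists (Ordinal (ltn_pmod j (isT : 0 < 4)%N)) => /=.
  by rewrite -E ?ltn_pmod// mulnC -divn_eq.
by exists (4 * j + a)%N; [rewrite expnS; have := ltn_ord a; lia|rewrite E].
Qed.

Lemma expi_neq0 theta : expi theta != 0.
Proof.
apply/eqP => /eqP; rewrite eq_complex /= => /andP[/eqP c0 /eqP s0].
by have := cos2Dsin2 theta; rewrite c0 s0 expr0n addr0 => /esym/eqP; rewrite oner_eq0.
Qed.

(** One direction is Cauchy-Schwarz against the unit vector of angle [theta], from the Lagrange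
    identity. For the other, the centre is moved along this vector by the difference of the
    projections. *)
Lemma orth_proj_disk theta (c : R[i]) (r t : R) :
  (exists2 z, disk c r z & complex.Re z * cos theta + complex.Im z * sin theta = t)
  <-> `|t - (complex.Re c * cos theta + complex.Im c * sin theta)| <= r.
Proof.
have cs := cos2Dsin2 theta.
case: c => a b /=; split=> [[[x y]]|h].
  rewrite /disk /= normc_def /= lecR => h <-.
  apply: le_trans h; rewrite -sqrtr_sqr ler_wsqrtr//.
  have lagrange (u v p q : R) :
      (u ^+ 2 + v ^+ 2) * (p ^+ 2 + q ^+ 2) =
      (u * p + v * q) ^+ 2 + (u * q - v * p) ^+ 2 by ring.
  have := lagrange (x - a) (y - b) (cos theta) (sin theta).
  rewrite cs mulr1 => ->; rewrite -[leLHS]addr0 lerD ?sqr_ge0//.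
  by rewrite (_ : _ - _ = (x - a) * cos theta + (y - b) * sin theta)//; ring.
set p := a * cos theta + b * sin theta in h.
exists ((a + (t - p) * cos theta) +i* (b + (t - p) * sin theta))%C; last first.
  rewrite /=; transitivity (p + (t - p) * (cos theta ^+ 2 + sin theta ^+ 2)).
    by rewrite /p; ring.
  by rewrite cs; ring.
rewrite /disk /= normc_def /= lecR; apply: le_trans h.
rewrite (_ : _ + _ = (t - p) ^+ 2 * (cos theta ^+ 2 + sin theta ^+ 2)); last by ring.
by rewrite cs mulr1 sqrtr_sqr.
Qed.

Lemma line_measure_disks w theta n :
  line_measure theta (orth_proj theta (disks w n)) =
  lebesgue_measure (shadow w theta n 0 0).
Proof.
rewrite /line_measure; congr lebesgue_measure; apply/seteqP.
suff H t : orth_proj theta (disks w n) (t%:C%C * expi theta) <->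
    shadow w theta n 0 0 t by split => t /H.
have := shadow_disks w theta n 0 t; rewrite add0n => sd.
have sd0 : (exists2 j, (j < 4 ^ n)%N &
     `|t - centre_proj w theta n j| <= 4 ^- n) <-> shadow w theta n 0 0 t.
  have c0 : centre_proj w theta 0 0 = 0 by rewrite /centre_proj /= !mul0r addr0.
  rewrite sd; split => [[[|//] _]|h].
    by rewrite c0 subr0 expr0 mul1r.
  by exists 0%N => //; rewrite c0 subr0 expr0 mul1r.
rewrite -sd0; split=> [[z [[//|j] /= jn zj]]|[j jn h]].
  move=> /(mulIf (expi_neq0 theta)) [zt]; exists j => //.
  by apply/orth_proj_disk; exists z.
have [z zj zt] := (orth_proj_disk theta (centre w n j.+1) (4 ^- n) t).2 h.
by exists z; [exists j.+1|rewrite zt].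
Qed.


(* Indices of the angles in the subtree rooted at the disk number [j + 1] of
   depth [k]. *)
Definition subtree k j : set (nat * nat) :=
  [set v | [&& (k < v.1)%N, (0 < v.2)%N & (v.2.-1 %/ 4 ^ (v.1 - k.+1) == j)%N]].

Lemma subtree_tree_vertex k j : (j < 4 ^ k)%N ->
  subtree k j `<=` [set v | tree_vertex v].
Proof.
move=> jk [k' [|j']] /and3P[/= kk' // _ /eqP jE].
apply/and3P; split => //=; first exact: leq_ltn_trans kk'.
rewrite (_ : k' - 1 = k + (k' - k.+1))%N; last by lia.
by rewrite expnD -ltn_divLR ?expn_gt0// jE.
Qed.

Lemma subtree_root k j : subtree k j (k.+1, j.+1).
Proof. by rewrite /subtree /= ltnSn subnn expn0 divn1 eqxx. Qed.

Lemma subtree_childN k j l : ~ subtree k.+1 l (k.+1, j.+1).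
Proof. by rewrite /subtree /= ltnn. Qed.

Lemma subtree_child k j a : (a < 4)%N ->
  subtree k.+1 (4 * j + a) `<=` subtree k j.
Proof.
move=> a4 [k' [|j']] /and3P[/= kk' // _ /eqP jE].
apply/and3P; split => //=; first exact: ltnW.
rewrite (_ : k' - k.+1 = (k' - k.+2).+1)%N; last by lia.
by rewrite expnSr divnMA jE mulnC divnMDl// divn_small// addn0.
Qed.

Lemma subtree_disjoint k j l : j != l -> subtree k j `&` subtree k l = set0.
Proof.
move=> /eqP jl; apply/seteqP; split => // v [/and3P[_ _ /eqP jE]].
by move=> /and3P[_ _ /eqP lE]; apply: jl; rewrite -jE.
Qed.

Lemma measurable_offset (d : measure_display) (S : measurableType d) a
  (phi : S -> R) : measurable_fun setT phi ->
  measurable_fun setT (fun y => offset a (phi y)).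
Proof.
move=> mphi; rewrite /offset; apply: measurable_funM => //.
apply: measurableT_comp; last exact: measurable_funB.
apply: continuous_measurable_fun. exact: continuous_cos.
Qed.

(** Measurability is joint in angles, direction and point, and only the angles of the subtree are
    assumed measurable. So the lemma applies to the sigma-algebra of a subtree as well as to the
    product spaces needed for Tonelli. *)
Lemma measurable_shadow (d : measure_display) (S : measurableType d)
    (w : nat -> nat -> S -> R) (theta s : S -> R) m k j :
  (forall v, subtree k j v -> measurable_fun setT (w v.1 v.2)) ->
  measurable_fun setT theta -> measurable_fun setT s ->
  measurable [set y | shadow (fun p q => w p q y) (theta y) m k j (s y)].
Proof.
move=> + mtheta; elim: m k j s => [|m IH] k j s mw ms /=.
  rewrite (_ : mkset _ = ((@Num.norm _ _) \o s) @^-1` `]-oo, 1]).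
    have mn : measurable_fun setT ((@Num.norm _ _) \o s).
      exact: measurableT_comp.
    by rewrite -[_ @^-1` _]setTI; apply: mn.
  by apply/seteqP; split => y /=; rewrite in_itv.
rewrite (_ : mkset _ = \bigcup_(a in [set: 'I_4])
    [set y | shadow (fun p q => w p q y) (theta y) m k.+1 (4 * j + a)
       (4 * s y - offset a (w k.+1 j.+1 y + theta y))]).
  apply: fin_bigcup_measurable => // a _; apply: IH.
    by move=> v /subtree_child => /(_ (ltn_ord a)) /mw.
  apply: measurable_funB; first exact: measurable_funM.
  by apply/measurable_offset/measurable_funD => //; exact: (mw _ (subtree_root _ _)).
by apply/seteqP; split => y /= [a]; exists a.
Qed.

End shadow.

(** * Conditioning on the root angle *)

Section recursion.
Context (R : realType) (d : measure_display) (T : measurableType d)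
  (P : probability T R) (omega : nat -> nat -> {RV P >-> R}).
Context (omega_indep : mutually_independent [set v | tree_vertex v]
    (fun v : nat * nat => omega v.1 v.2))
  (omega_unif : forall k j : nat, tree_vertex (k, j) ->
    forall A : set R, measurable A ->
    distribution P (omega k j) A = uniform_prob (pi2_gt0 R) A).

Let X (v : nat * nat) := omega v.1 v.2.
Local Notation U := (uniform_prob (pi2_gt0 R)).

Lemma integral_angle k j (p : R -> \bar R) : tree_vertex (k, j) ->
  measurable_fun setT p -> (forall r, 0 <= p r)%E ->
  (\int[distribution P (omega k j)]_r p r = \int[U]_r p r)%E.
Proof.
move=> kj mp p0.
have mid : measurable_fun setT (fun r : measurableTypeR R => r : R).
  exact: measurable_id.
(* The identity passes between the two measurable structures on the reals that carry [U] and the law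
   of the angle. *)
pose idR : {mfun measurableTypeR R >-> R} :=
  HB.pack (fun r : measurableTypeR R => r : R)
    (isMeasurableFun.Build _ _ _ _ _ mid).
transitivity (\int[pushforward U idR]_r p r)%E; last first.
  by rewrite ge0_integral_pushforward.
by apply: eq_measure_integral => A mA _; exact: omega_unif.
Qed.

(** The complement is the convenient event: a point is missed when all four children miss it, and
    independence makes this a product. *)
Definition missed theta m k j s : set T :=
  [set x | ~ shadow (fun p q => omega p q x) theta m k j s].

Lemma measurable_RV_cylinder (V : set (nat * nat)) v : V v ->
  measurable_fun (setT : set (g_sigma_algebraType (cylinder X V))) (X v).
Proof.
move=> Vv _ B mB; rewrite setTI; apply: sub_sigma_algebra.
exact: cylinder1.
Qed.

Lemma missed_cylinder theta m k j s :
  <<s cylinder X (subtree k j) >> (missed theta m k j s).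
Proof.
apply: (@measurableC _ (g_sigma_algebraType (cylinder X (subtree k j)))).
apply: (@measurable_shadow _ _ (g_sigma_algebraType (cylinder X (subtree k j)))
  (fun p q => omega p q) (cst theta) (cst s)) => // v.
exact: measurable_RV_cylinder.
Qed.

(** Condition on the angle [r] at the root of the subtree, which is independent of the angles below
    it. For fixed [r], the misses by the four children depend on disjoint subtrees, so their
    probabilities multiply. *)
Lemma missed_rec theta m k j s : (j < 4 ^ k)%N ->
  let p (r : R) := (\prod_(a < 4) P (missed theta m k.+1 (4 * j + a)
                            (4 * s - offset a (r + theta))))%E in
  measurable_fun setT p /\ P (missed theta m.+1 k j s) = (\int[U]_r p r)%E.
Proof.
move=> jk p.
have child_lt a : (a < 4)%N -> (4 * j + a < 4 ^ k.+1)%N.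
  by move=> a4; rewrite expnS; lia.
pose V a := subtree k.+1 (4 * j + a).
pose W : set (nat * nat) := [set v | exists2 a, (a < 4)%N & V a v].
pose S := g_sigma_algebraType (cylinder X W).
pose E r a := missed theta m k.+1 (4 * j + a) (4 * s - offset a (r + theta)).
pose Z : set (R * S) := \bigcap_(a in [set: 'I_4]) [set y | E y.1 a y.2].
have VD a : (a < 4)%N -> V a `<=` [set v | tree_vertex v].
  by move=> a4; apply: subtree_tree_vertex; exact: child_lt.
have mZ : measurable Z.
  apply: fin_bigcap_measurable => // a _; apply: measurableC.
  apply: (@measurable_shadow _ _ (R * S)%type (fun p q y => omega p q y.2)
    (cst theta) (fun y => 4 * s - offset a (y.1 + theta))) => //.
  - move=> v Vav.
    have mX : measurable_fun (setT : set S) (X v).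
      by apply: measurable_RV_cylinder; exists (val a) => /=.
    exact: (measurableT_comp mX measurable_snd).
  - apply: measurable_funB => //; apply: measurable_offset.
    by apply: (@measurable_funD _ _ _ _ fst (cst theta)).
have pE : p = fun r => P [set x | Z (r, x)].
  apply/funext => r; rewrite /p.
  rewrite -(sigma_cylinder_bigcap omega_indep (V := V) (A := E r))//.
  - congr (P _); rewrite -bigcap_mkord; apply/seteqP; split => x Ex.
      by move=> a _; exact: (Ex a (ltn_ord a)).
    by move=> a /= a4; exact: (Ex (Ordinal a4)).
  - move=> a b /andP[ab b4]; apply: subtree_disjoint.
    by rewrite eqn_add2l neq_ltn ab.
  - by move=> a a4; exact: missed_cylinder.
have vroot : tree_vertex (k.+1, j.+1).
  exact: (subtree_tree_vertex jk (subtree_root k j)).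
have [] := sigma_cylinder_joint_law omega_indep _ vroot _ mZ.
- by move=> v [a a4 /(VD a a4)].
- by move=> [a a4]; exact: subtree_childN.
rewrite -pE => mp jE; split => //.
rewrite (_ : missed _ _ _ _ _ = [set x | Z (X (k.+1, j.+1) x, x)]).
  rewrite jE; apply: (@integral_angle k.+1 j.+1) => // r.
  by rewrite /p; apply: prode_ge0 => a _.
apply/seteqP; split => x /= h.
  by move=> a _ ha; apply: h; exists a.
by move=> [a ha]; apply: (h a I ha).
Qed.

End recursion.

(** * Deterministic upper bounds for the hitting probabilities *)

Section affine_change.
Context (R : realType).
Local Notation mu := (@lebesgue_measure R).
Local Open Scope ereal_scope.

Lemma measurable_affine (a b : R) :
  measurable_fun setT (fun s : measurableTypeR R => (a * s + b)%R : measurableTypeR R).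
Proof. by apply: measurable_funD => //; exact: measurable_funM. Qed.

(** Lebesgue measure is [a] times its image under the affine map, since both agree on half-open
    intervals. *)
Lemma ge0_integral_affine (a b : R) (D : set (measurableTypeR R))
    (f : measurableTypeR R -> \bar R) :
  (0 < a)%R -> measurable D -> measurable_fun setT f -> (forall x, 0 <= f x) ->
  \int[mu]_(s in D) f s =
  a%:E * \int[mu]_(s in (fun s => a * s + b)%R @^-1` D) f (a * s + b)%R.
Proof.
move=> a0 mD mf f0.
pose phi := fun s : measurableTypeR R => (a * s + b)%R : measurableTypeR R.
have mphi : measurable_fun setT phi := measurable_affine a b.
pose push : {measure set (measurableTypeR R) -> \bar R} :=
  mscale (NngNum (ltW a0)) (pushforward mu phi).
pose nu := push mphi.
have muE A : measurable A -> mu A = nu A.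
  apply: lebesgue_measure_unique => _ [[c d] _ <-].
  rewrite /nu /= /mscale /= /pushforward.
  rewrite (_ : phi @^-1` _ = `]((c - b) / a)%R, ((d - b) / a)%R]%classic).
    rewrite !lebesgue_measure_itv /= !lte_fin ltr_pM2r ?invr_gt0// ltrD2r.
    case: ifPn => _; last by rewrite mule0.
    rewrite -!EFinD -EFinM; congr EFin; field; exact: lt0r_neq0.
  apply/seteqP; split => s /=; rewrite !in_itv /=;
    by rewrite ltr_pdivrMr// ler_pdivlMr// ltrBlDr lerBrDr mulrC.
transitivity (\int[nu]_(s in D) f s).
  by apply: eq_measure_integral => A mA _; exact: muE.
rewrite ge0_integral_mscale//=; last exact: measurable_funTS.
by rewrite ge0_integral_pushforward//; exact: measurable_funTS.
Qed.

End affine_change.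

(** * Averaging over the root angle: from one profile to the next *)

Section refinement.
Context (R : realType).
Implicit Types (F : R -> R) (s r : R).
Local Notation mu := (@lebesgue_measure R).
Local Notation U := (uniform_prob (pi2_gt0 R)).

Lemma offset0 r : offset 0 r = 3 * cos r.
Proof. by rewrite /offset mul0r sub0r cosN. Qed.

Lemma offset1 r : offset 1 r = 3 * sin r.
Proof. by rewrite /offset mul1r -cosN opprB cosBpihalf. Qed.

Lemma offset2 r : offset 2 r = - (3 * cos r).
Proof.
rewrite /offset -cosN opprB (_ : r - _ = r - pi / 2 - pi / 2); last by field.
by rewrite cosBpihalf sinBpihalf mulrN.
Qed.

Lemma offset3 r : offset 3 r = - (3 * sin r).
Proof.
rewrite /offset -cosN opprB.
rewrite (_ : r - _ = r - pi / 2 - pi / 2 - pi / 2); last by field.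
by rewrite cosBpihalf sinBpihalf cosBpihalf mulrN.
Qed.

Lemma offset_le a r : `|offset a r| <= 3.
Proof.
rewrite /offset normrM gtr0_norm// -[leRHS]mulr1 ler_pM2l// ler_norml.
by rewrite cos_geN1 cos_le1.
Qed.

Lemma continuous_offset a : continuous (@offset R a).
Proof.
move=> r; apply: cvgM; first exact: cvg_cst.
apply: continuous_comp; last exact: continuous_cos.
by apply: cvgB; [exact: cvg_cst|exact: cvg_id].
Qed.

(* The continuous profiles [F] below dominate the hitting probability
   [s |-> P (s is in shadow m)]; [branch F s phi] is the corresponding lower
   bound for the probability that [s] is missed by all four children. *)
Definition branch F s phi : R := \prod_(a < 4) (1 - F (4 * s - offset a phi)).

(** If [F] bounds the hitting probability for [m] generations, this bounds it for [m + 1]. *)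
Definition next_bound F s : R := 1 - \int[U]_r branch F s r.

(** Two points of the support differ by at most 3, the amplitude of [gap] below. Continuity serves
    the change of variables in [mass_le_gap]. *)
Definition profile F : Prop :=
  [/\ continuous F, forall s, 0 <= F s <= 1 &
      forall s, 3 / 2 <= `|s| -> F s = 0].

(** A continuous majorant of the indicator of [-1, 1], the shadow of a single disk. *)
Definition tent s : R := Num.max 0 (Num.min 1 (3 - 2 * `|s|)).

Lemma tent_profile : profile tent.
Proof.
split=> [s|s|s s32].
- apply: (@continuous_max _ _ (cst 0) (cst 1 \min (fun s => 3 - 2 * `|s|))).
    exact: cvg_cst.
  apply: (@continuous_min _ _ (cst 1) (fun s => 3 - 2 * `|s|)).
    exact: cvg_cst.
  apply: cvgB; first exact: cvg_cst.
  by apply: cvgM; [exact: cvg_cst|exact: norm_continuous].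
- by rewrite /tent le_max lexx /= ge_max ler01 ge_min lexx.
- by apply/max_idPl; rewrite ge_min; apply/orP; right; lra.
Qed.

Lemma tent1 s : `|s| <= 1 -> tent s = 1.
Proof.
move=> s1; rewrite /tent (min_idPl _); last by lra.
exact/max_idPr.
Qed.

Lemma branchE F s r : branch F s r =
  (1 - F (4 * s - 3 * cos r)) * (1 - F (4 * s - 3 * sin r))
  * (1 - F (4 * s + 3 * cos r)) * (1 - F (4 * s + 3 * sin r)).
Proof.
rewrite /branch !big_ord_recr big_ord0 /= mul1r.
by rewrite offset0 offset1 offset2 offset3 !opprK.
Qed.

(** A shift by [pi / 2] permutes the four offsets cyclically. *)
Lemma branch_periodic F s r : branch F s (r + pi / 2) = branch F s r.
Proof. by rewrite !branchE cosDpihalf sinDpihalf mulrN opprK; ring. Qed.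

Lemma branch_ge0_le1 F s r : profile F -> 0 <= branch F s r <= 1.
Proof.
move=> [_ F01 _]; apply/andP; split.
  by apply: prodr_ge0 => a _; rewrite subr_ge0; have /andP[] := F01 (4 * s - offset a r).
apply: le_trans (_ : \prod_(a < 4) 1 <= 1); last by rewrite big1.
apply: ler_prod => a _; have /andP[F0 F1] := F01 (4 * s - offset a r).
by rewrite subr_ge0 F1 gerBl.
Qed.

Lemma continuous_branch F (g h : R -> R) : profile F ->
  continuous g -> continuous h -> continuous (fun x => branch F (g x) (h x)).
Proof.
move=> [cF _ _] cg ch x.
have c1 a : (1 - F (4 * g y - offset a (h y))) @[y --> x] -->
    1 - F (4 * g x - offset a (h x)).
  apply: cvgB; first exact: cvg_cst.
  apply: (@continuous_comp _ _ _ (fun y => 4 * g y - offset a (h y)) F); last exact: cF.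
  apply: cvgB; first by apply: cvgM; [exact: cvg_cst|exact: cg].
  by apply: (@continuous_comp _ _ _ h); [exact: ch|exact: continuous_offset].
have -> : (fun y => branch F (g y) (h y)) = (fun y =>
    (1 - F (4 * g y - offset 0 (h y))) * (1 - F (4 * g y - offset 1 (h y)))
    * (1 - F (4 * g y - offset 2 (h y))) * (1 - F (4 * g y - offset 3 (h y)))).
  by apply/funext => y; rewrite /branch !big_ord_recr big_ord0 /= mul1r.
by do 3 (apply: cvgM; last exact: c1); exact: c1.
Qed.

Lemma branch_integrable F s : profile F ->
  U.-integrable setT (EFin \o branch F s).
Proof.
move=> pF.
have mb : measurable_fun (setT : set (measurableTypeR R)) (branch F s).
  apply: continuous_measurable_fun.
  apply: (@continuous_branch F (cst s) id pF) => x; last exact: cvg_id.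
  exact: cvg_cst.
apply: (@le_integrable _ _ _ _ _ _ _ (EFin \o cst 1)) => //.
- exact/measurable_EFinP.
- move=> r _ /=; have /andP[b0 b1] := branch_ge0_le1 s r pF.
  by rewrite lee_fin normr1 ger0_norm.
- exact: finite_measure_integrable_cst.
Qed.

Lemma integral_branch_fin_num F s : profile F ->
  (\int[U]_r (branch F s r)%:E)%E = (\int[U]_r branch F s r)%:E.
Proof.
by move=> pF; rewrite /Rintegral fineK//; apply: integrable_fin_num => //; exact: branch_integrable.
Qed.

Lemma next_bound_profile F : profile F -> profile (next_bound F).
Proof.
move=> pF; have [_ F01 F0] := pF; split=> [s|s|s s32].
- apply: cvgB; first exact: cvg_cst.
  (* Dominated convergence near [s], with the constant 1 as dominating function. *)
  apply: (@continuity_under_integral _ _ _ U (branch F) setT _ (s - 1) (s + 1)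
    _ _ (cst 1)) => //.
  + by move=> x _; exact: branch_integrable.
  + apply/aeW => r _ x _; apply: (@continuous_branch F id (cst r) pF) => y.
      exact: cvg_id.
    exact: cvg_cst.
  + exact: finite_measure_integrable_cst.
  + move=> x _; apply/aeW => r _; have /andP[b0 b1] := branch_ge0_le1 x r pF.
    by rewrite ger0_norm.
  + by rewrite inE /= in_itv /= gtrBl ltrDl ltr01.
- rewrite /next_bound subr_ge0 gerBl andbC -!lee_fin -integral_branch_fin_num//.
  apply/andP; split.
    by apply: integral_ge0 => r _; rewrite lee_fin; have /andP[] := branch_ge0_le1 s r pF.
  rewrite -[leRHS](@probability_setT _ _ _ U) -[leRHS]mul1e -integral_cst//.
  apply: ge0_le_integral => //=.
  + by move=> r _; rewrite lee_fin; have /andP[] := branch_ge0_le1 s r pF.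
  + by have /integrableP[] := branch_integrable s pF.
  + by move=> r _; rewrite lee_fin; have /andP[] := branch_ge0_le1 s r pF.
(* Here [4 * s] is at least 6 in absolute value and an offset at most 3, so all four arguments of
   [F] lie outside its support. *)
- have b1 r : branch F s r = 1.
    rewrite /branch big1// => a _; rewrite F0 ?subr0//.
    have := offset_le a r; have := ler_normD (4 * s - offset a r) (offset a r).
    by rewrite subrK normrM (@gtr0_norm _ 4)//; lra.
  rewrite /next_bound (_ : branch F s = cst 1); last exact/funext.
  by rewrite Rintegral_cst// mul1r [X in fine X]probability_setT subrr.
Qed.

End refinement.

(** * Eliminating the direction by periodicity *)

Section periodic.
Context (R : realType).
Local Notation mu := (@lebesgue_measure R).
Local Notation U := (uniform_prob (pi2_gt0 R)).
Local Open Scope ereal_scope.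

Lemma ge0_integral_itv_shift (a b c : R) (g : measurableTypeR R -> \bar R) :
  measurable_fun setT g -> (forall r, 0 <= g r) ->
  \int[mu]_(r in `]a, b]) g (r + c)%R = \int[mu]_(r in `](a + c)%R, (b + c)%R]) g r.
Proof.
move=> mg g0; rewrite [RHS](ge0_integral_affine c ltr01)// mul1e.
rewrite (_ : _ @^-1` _ = `]a, b]%classic).
  by apply: eq_integral => r _; rewrite mul1r.
by apply/seteqP; split => r; rewrite /= !in_itv /= mul1r ltrD2r lerD2r.
Qed.

(** The shifted window []c, t + c]] is cut at [t], and the part beyond [t] is moved back by one
    period onto []0, c]]. *)
Lemma ge0_integral_periodic (t c : R) (g : measurableTypeR R -> \bar R) :
  measurable_fun setT g -> (forall r, 0 <= g r) ->
  (forall r, g (r + t)%R = g r) -> (0 <= c <= t)%R ->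
  \int[mu]_(r in `[0%R, t]) g (r + c)%R = \int[mu]_(r in `[0%R, t]) g r.
Proof.
move=> mg g0 gt /andP[c0 ct].
have mgc : measurable_fun setT (fun r : measurableTypeR R => g (r + c)%R).
  apply: (measurableT_comp mg).
  exact: (@measurable_funD _ _ _ _ id (cst c)).
rewrite -!integral_itv_obnd_cbnd; [|exact: measurable_funTS..].
rewrite ge0_integral_itv_shift// add0r.
rewrite (@itv_bndbnd_setU _ _ _ (BRight t))/=; [|by rewrite bnd_simp ..|by rewrite bnd_simp lerDl].
rewrite ge0_integral_setU//=; last 2 first.
- exact: measurable_funTS.
- by apply/disj_setPS => r [/=]; rewrite !in_itv /= => /andP[_ rt] /andP[/lt_geF]; rewrite rt.
rewrite -[X in `]X, (t + c)%R]](add0r t) [X in `](0 + t)%R, X]]addrC.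
rewrite -ge0_integral_itv_shift//.
under [X in _ + X]eq_integral do rewrite gt.
rewrite addeC -ge0_integral_setU//=.
- by rewrite -itv_bndbnd_setU// bnd_simp.
- exact: measurable_funTS.
- by apply/disj_setPS => r [/=]; rewrite !in_itv /= => /andP[_ rt] /andP[/lt_geF]; rewrite rt.
Qed.

Lemma integral_branch_rotate (F : R -> R) (s theta : R) : profile F ->
  (0 <= theta <= pi)%R ->
  \int[U]_r (branch F s (r + theta))%:E = (1 - next_bound F s)%:E.
Proof.
move=> pF /andP[t0 tpi].
have mb : measurable_fun setT (fun r : measurableTypeR R => (branch F s r)%:E).
  by have /integrableP[] := branch_integrable s pF.
have b0 r : 0 <= (branch F s r)%:E.
  by rewrite lee_fin; have /andP[] := branch_ge0_le1 s r pF.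
have mbc c : measurable_fun setT (fun r : measurableTypeR R => (branch F s (r + c))%:E).
  apply: (measurableT_comp mb).
  exact: (@measurable_funD _ _ _ _ id (cst c)).
rewrite /next_bound subKr -integral_branch_fin_num// !integral_uniform//; congr (_ * _).
have per r : (branch F s (r + pi / 2))%:E = (branch F s r)%:E.
  by rewrite branch_periodic.
have [tpi2|tpi2] := leP theta (pi / 2)%R.
  by apply: (ge0_integral_periodic mb b0 per); rewrite t0.
(* Beyond [pi / 2], one period is removed so that the remaining shift lies in the range of
   [ge0_integral_periodic]. *)
under eq_integral => r _.
  rewrite (_ : (r + theta = r + (theta - pi / 2) + pi / 2)%R); last by field.
  rewrite per; over.
apply: (ge0_integral_periodic mb b0 per); lra.
Qed.

End periodic.

(** * Lower bound for the overlap of two siblings *)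

Section overlap.
Context (R : realType).
Implicit Types (F : R -> R).
Local Notation mu := (@lebesgue_measure R).
Local Notation U := (uniform_prob (pi2_gt0 R)).

(** This is [offset 0 phi - offset 1 phi]: if the first child sees the point [t], the second sees
    [t + gap phi]. *)
Definition gap (phi : R) : R := 3 * cos phi - 3 * sin phi.

Lemma is_derive_gap (phi : R) :
  is_derive phi (1 : R) gap (- (3 * (sin phi + cos phi))).
Proof.
have -> : gap = (3 *: cos - 3 *: sin : R -> R) by [].
apply: is_derive_eq.
by rewrite /GRing.scale /=; ring.
Qed.

Lemma derive1_gap : (derive1 gap) = fun phi => - (3 * (sin phi + cos phi)).
Proof.
by apply/funext => phi; rewrite derive1E; apply: (@derive_val _ _ _ _ _ _ _ (is_derive_gap phi)).
Qed.

Lemma continuous_gap : continuous gap.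
Proof.
move=> phi; apply: differentiable_continuous; apply/derivable1_diffP.
by have [] := is_derive_gap phi.
Qed.

Lemma continuous_derive1_gap : continuous (derive1 gap).
Proof.
rewrite derive1_gap => phi; apply: cvgN; apply: cvgM; first exact: cvg_cst.
by apply: cvgD; [exact: continuous_sin|exact: continuous_cos].
Qed.

Lemma gap_decreasing :
  {in `[0, pi / 2] &, {homo gap : x y /~ (x < y)}}.
Proof.
have pi0 := pi_gt0 R.
move=> x y; rewrite !in_itv /= => /andP[x0 xp] /andP[y0 yp] yx.
have cxy : cos x < cos y by rewrite ltr_cos// in_itv /=; apply/andP; split; lra.
have sxy : sin y < sin x by rewrite ltr_sin// in_itv /=; apply/andP; split; lra.
rewrite /gap; lra.
Qed.

Local Open Scope ereal_scope.

Definition mass F : \bar R := \int[mu]_s (F s)%:E.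

Lemma measurable_profile F : profile F ->
  measurable_fun (setT : set (measurableTypeR R)) (fun s => (F s)%:E).
Proof.
move=> [cF _ _].
have mF : measurable_fun (setT : set (measurableTypeR R)) F.
  exact: continuous_measurable_fun.
exact/measurable_EFinP.
Qed.

(** Substitute [x = gap phi], which decreases from 3 to -3 with speed [3 * (sin phi + cos phi)], at
    most 6. The interval [r - 3, r + 3] contains the support of [F] because [r] is within 3/2 of
    0. *)
Lemma mass_le_gap F (r : R) : profile F -> (`|r| <= 3 / 2)%R ->
  mass F <= 6%:E * \int[mu]_(phi in `[0%R, (pi / 2)%R]) (F (r + gap phi))%:E.
Proof.
move=> pF r32; have mF := measurable_profile pF; have [cF F01 F0] := pF.
have F_ge0 s : (0 <= F s)%R by have /andP[] := F01 s.
have gap0 : gap 0 = 3%R by rewrite /gap cos0 sin0; ring.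
have gappi : gap (pi / 2) = (- 3)%R by rewrite /gap cos_pihalf sin_pihalf; ring.
have cFr : continuous (fun x => F (r + x)%R).
  move=> x; apply: (@continuous_comp _ _ _ (fun x => r + x)%R F); last exact: cF.
  by apply: cvgD; [exact: cvg_cst|exact: cvg_id].
have mFr (h : R -> R) : continuous h ->
    measurable_fun (setT : set (measurableTypeR R)) (fun x => (F (r + h x))%:E).
  move=> ch; apply: (measurableT_comp mF).
  have mh : measurable_fun (setT : set (measurableTypeR R)) h.
    exact: continuous_measurable_fun.
  exact: (@measurable_funD _ _ _ _ (cst r) h).
have -> : mass F = \int[mu]_(x in `[(- 3)%R, 3%R]) (F (r + x))%:E.
  transitivity (\int[mu]_(s in `[(r - 3)%R, (r + 3)%R]) (F s)%:E).
    rewrite integral_mkcond; apply: eq_integral => s _; rewrite patchE.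
    case: ifPn => //; rewrite notin_setE /= in_itv /= => /negP h.
    rewrite F0// leNgt; apply: contra h; rewrite ltr_norml => /andP[s1 s2].
    by move: r32; rewrite ler_norml => /andP[r1 r2]; apply/andP; split; lra.
  rewrite (ge0_integral_affine r ltr01)//.
  rewrite mul1e (_ : _ @^-1` _ = `[(- 3)%R, 3%R]%classic).
    by apply: eq_integral => x _; rewrite mul1r addrC.
  apply/seteqP; split => x; rewrite /= !in_itv /= mul1r => /andP[x1 x2];
    by apply/andP; split; lra.
rewrite -gappi -{1}gap0.
rewrite (integration_by_substitution_decreasing (ltW (pi2_gt0 R)) gap_decreasing)//; first last.
- by apply: continuous_subspaceT => x; exact: cFr.
- split.
  + by move=> x _; have [] := is_derive_gap x.
  + by apply: cvg_at_right_filter; exact: continuous_gap.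
  + by apply: cvg_at_left_filter; exact: continuous_gap.
- by apply/cvg_ex; eexists; apply: cvg_at_left_filter; exact: continuous_derive1_gap.
- by apply/cvg_ex; eexists; apply: cvg_at_right_filter; exact: continuous_derive1_gap.
- by move=> x _; exact: continuous_derive1_gap.
rewrite -ge0_integralZl//; last 2 first.
- by apply: measurable_funTS; apply: mFr; exact: continuous_gap.
- by move=> x _; rewrite lee_fin.
rewrite derive1_gap (_ : (fun _ => _) =
    fun x => (F (r + gap x) * (3 * (sin x + cos x)))%:E); last first.
  by apply/funext => x; rewrite -[(- _)%R in LHS]/(- - _)%R opprK.
have mG := mFr _ continuous_gap.
apply: ge0_le_integral => //=.
- move=> x; rewrite in_itv /= => /andP[x0 xp]; rewrite lee_fin.
  rewrite mulr_ge0// mulr_ge0// addr_ge0//.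
    by apply: sin_ge0_pi; rewrite x0 /= (le_trans xp)//; have := pi_gt0 R; lra.
  by apply: cos_ge0_pihalf; rewrite xp (le_trans _ x0)//; have := pi_gt0 R; lra.
- apply: measurable_funTS; apply/measurable_EFinP; apply: measurable_funM.
    exact/measurable_EFinP.
  apply: continuous_measurable_fun => x.
  apply: cvgM; first exact: cvg_cst.
  by apply: cvgD; [exact: continuous_sin|exact: continuous_cos].
- by apply: measurable_funTS; exact: measurable_funeM.
- move=> x _; rewrite -EFinM lee_fin mulrC ler_wpM2r//.
  have := sin_le1 x; have := cos_le1 x; lra.
Qed.

(** The constant is 1/6 from [mass_le_gap] times the density [2 / pi] of the uniform law. *)
Lemma mass_le_mean_gap F (r : R) : profile F -> (`|r| <= 3 / 2)%R ->
  (3 * pi)^-1%:E * mass F <= \int[U]_phi (F (r + gap phi))%:E.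
Proof.
move=> pF r32; have mF := measurable_profile pF; have [cF F01 _] := pF.
have F_ge0 s : (0 <= F s)%R by have /andP[] := F01 s.
rewrite integral_uniform//; last 2 first.
- apply: (measurableT_comp mF).
  have mh : measurable_fun (setT : set (measurableTypeR R)) gap.
    by apply: continuous_measurable_fun; exact: continuous_gap.
  exact: (@measurable_funD _ _ _ _ (cst r) gap).
- by move=> x; rewrite lee_fin.
have := mass_le_gap pF r32; set J := (\int[_]_(_ in _) _).
move=> h; apply: (@le_trans _ _ ((3 * pi)^-1%:E * (6%:E * J))).
  by rewrite lee_pmul2l// lte_fin invr_gt0 mulr_gt0// pi_gt0.
rewrite muleA -EFinM (_ : (3 * pi)^-1 * 6 = (pi / 2 - 0)^-1)%R//.
by have := pi_gt0 R; move: (@pi R) => p p0; field; exact: lt0r_neq0.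
Qed.

End overlap.

(** * Quadratic loss of mass in one generation *)

Section mass_recursion.
Context (R : realType).
Local Notation mu := (@lebesgue_measure R).
Local Notation U := (uniform_prob (pi2_gt0 R)).
Local Open Scope ereal_scope.


Context (F : R -> R) (pF : profile F).

Let F01 s : (0 <= F s <= 1)%R. Proof. by case: pF. Qed.
Let F_ge0 s : (0 <= F s)%R. Proof. by have /andP[] := F01 s. Qed.

Let measurable_F d (S : measurableType d) (g : S -> R) :
  measurable_fun setT g -> measurable_fun setT (fun y => F (g y)).
Proof.
move=> mg; apply: measurableT_comp => //.
by apply: continuous_measurable_fun; case: pF.
Qed.

Local Notation S2 := (measurableTypeR R * measurableTypeR R)%type.

Let measurable_child a :
  measurable_fun setT (fun p : S2 => F (4 * p.1 - offset a p.2)).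
Proof.
apply: measurable_F; apply: (@measurable_funB _ _ _ _ (fun p : S2 => 4 * p.1)%R).
  exact: (@measurable_funM _ _ _ _ (cst 4%R) fst).
exact: (@measurable_offset _ _ S2 a snd).
Qed.

Lemma integral_child (c : R) :
  \int[mu]_s (F (4 * s - c))%:E = 4^-1%:E * mass F.
Proof.
rewrite [in RHS]/mass [X in _ = _ * X](ge0_integral_affine (- c) (ltr0Sn _ 3))//.
  by rewrite muleA -EFinM mulVf// mul1e preimage_setT.
exact: measurable_profile.
Qed.

Lemma next_boundE s : (next_bound F s)%:E = \int[U]_r (1 - branch F s r)%:E.
Proof.
have [mb _] := integrableP _ _ _ (branch_integrable s pF).
rewrite EFinB; under [RHS]eq_integral do rewrite EFinB.
rewrite integralB//; last 2 first.
- exact: finite_measure_integrable_cst.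
- exact: branch_integrable.
rewrite integral_branch_fin_num// integral_cst// mul1e.
by rewrite [X in _ = X - _](@probability_setT _ _ _ U).
Qed.

(** A pointwise Bonferroni inequality, averaged over the root angle: in the union bound for four
    children, the overlap of the first two may be subtracted. *)
Lemma next_bound_child_le s :
  (next_bound F s)%:E
    + \int[U]_r (F (4 * s - offset 0 r) * F (4 * s - offset 1 r))%:E <=
  \int[U]_r (\sum_(a < 4) F (4 * s - offset a r))%:E.
Proof.
have [mb _] := integrableP _ _ _ (branch_integrable s pF).
have mc a : measurable_fun setT (fun r : measurableTypeR R => F (4 * s - offset a r)).
  apply: measurable_F; apply: (@measurable_funB _ _ _ _ (cst (4 * s))%R) => //.
  exact: (@measurable_offset _ _ (measurableTypeR R) a id).
have b01 r := branch_ge0_le1 s r pF.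
rewrite next_boundE -ge0_integralD//=.
- apply: ge0_le_integral => //=.
  + by move=> r _; rewrite -EFinD lee_fin addr_ge0 ?mulr_ge0// subr_ge0; have /andP[] := b01 r.
  + apply: emeasurable_funD; apply/measurable_EFinP.
      by apply: measurable_funB => //; exact/measurable_EFinP.
    by apply: measurable_funM; exact: mc.
  + by apply/measurable_EFinP; apply: measurable_sum => a; exact: mc.
  + move=> r _; rewrite -EFinD lee_fin branchE !big_ord_recr big_ord0 /= add0r.
    rewrite offset0 offset1 offset2 offset3 !opprK.
    have := (F01 (4 * s - 3 * cos r), F01 (4 * s - 3 * sin r),
      F01 (4 * s + 3 * cos r), F01 (4 * s + 3 * sin r))%R.
    move: (F (4 * s - 3 * cos r)) (F (4 * s - 3 * sin r))
      (F (4 * s + 3 * cos r)) (F (4 * s + 3 * sin r)) => x0 x1 x2 x3 [[[/andP[? ?] /andP[? ?]] /andP[? ?]] /andP[? ?]].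
    (* Expanding the last two factors of the product, [h] and [h'] show that it is at least
       [(1 - x0) * (1 - x1) - (x2 + x3)]. *)
    have h : ((1 - x0) * (1 - x1) * (x2 + x3) <= x2 + x3)%R.
      by rewrite ler_piMl ?addr_ge0// mulr_ile1 ?subr_ge0// gerBl.
    have h' : (0 <= (1 - x0) * (1 - x1) * (x2 * x3))%R by rewrite !mulr_ge0 ?subr_ge0.
    lra.
- by move=> r _; rewrite lee_fin subr_ge0; have /andP[] := b01 r.
- by apply/measurable_EFinP/measurable_funB => //; exact/measurable_EFinP.
- by move=> r _; rewrite lee_fin mulr_ge0.
- by apply/measurable_EFinP/measurable_funM; exact: mc.
Qed.

(** Integrate [next_bound_child_le] over [s]: the union bound preserves the mass, and the overlap
    costs a multiple of its square. *)
Lemma mass_next_bound :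
  mass (next_bound F) + (12 * pi)^-1%:E * (mass F * mass F) <= mass F.
Proof.
have [_ _ F0] := pF.
have mass0 : 0 <= mass F by apply: integral_ge0 => s _; rewrite lee_fin.
have mcc : measurable_fun setT (fun p : S2 =>
    (F (4 * p.1 - offset 0 p.2) * F (4 * p.1 - offset 1 p.2))%:E).
  by apply/measurable_EFinP/measurable_funM; exact: measurable_child.
have msum : measurable_fun setT (fun p : S2 =>
    (\sum_(a < 4) F (4 * p.1 - offset a p.2))%:E).
  by apply/measurable_EFinP/measurable_sum => a; exact: measurable_child.
have cc_ge0 (p : S2) :
    0 <= (F (4 * p.1 - offset 0 p.2) * F (4 * p.1 - offset 1 p.2))%:E.
  by rewrite lee_fin mulr_ge0.
have sum_ge0 (p : S2) : 0 <= (\sum_(a < 4) F (4 * p.1 - offset a p.2))%:E.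
  by rewrite lee_fin sumr_ge0.
(* After Tonelli, each child contributes a quarter of the mass, whatever its offset. *)
have sumE : \int[mu]_s \int[U]_r (\sum_(a < 4) F (4 * s - offset a r))%:E =
    mass F.
  rewrite (fubini_tonelli _ msum sum_ge0).
  transitivity (\int[U]_r (mass F)).
    apply: eq_integral => r _; under eq_integral do rewrite -sumEFin.
    rewrite ge0_integral_sum//; last 2 first.
    - move=> a; apply/measurable_EFinP.
      exact: (measurableT_comp (measurable_child a) (pair2_measurable r)).
    - by move=> a s _; rewrite lee_fin.
    rewrite (eq_bigr (fun=> 4^-1%:E * mass F)); last first.
      by move=> a _; exact: (integral_child (offset a r)).
    rewrite -ge0_sume_distrl//.
    by rewrite sumEFin sumr_const card_ord -(mulr_natl 4^-1%R) mulfV// mul1e.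
  by rewrite integral_cst// [X in _ * X](@probability_setT _ _ _ U) mule1.
(* The substitution [t = 4 * s - offset 0 r] gives a factor 1/4 and the integrand
   [F t * F (t + gap r)]. With the [1 / (3 * pi)] of [mass_le_mean_gap] this makes
   [1 / (12 * pi)]. *)
have ccE : (12 * pi)^-1%:E * (mass F * mass F) <=
    \int[mu]_s \int[U]_r (F (4 * s - offset 0 r) * F (4 * s - offset 1 r))%:E.
  rewrite (fubini_tonelli _ mcc cc_ge0).
  have mgap : measurable_fun setT (fun p : S2 => (F p.1 * F (p.1 + gap p.2))%:E).
    apply/measurable_EFinP/measurable_funM; first exact: measurable_F.
    apply: measurable_F; apply: (@measurable_funD _ _ _ _ fst) => //.
    apply: measurableT_comp => //.
    by apply: continuous_measurable_fun; exact: continuous_gap.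
  have gap_ge0 (p : S2) : 0 <= (F p.1 * F (p.1 + gap p.2))%:E.
    by rewrite lee_fin mulr_ge0.
  rewrite (_ : (\int[U]_r _) =
      4^-1%:E * \int[U]_r \int[mu]_t (F t * F (t + gap r))%:E); last first.
    rewrite -ge0_integralZl//; last 2 first.
    - exact: (measurable_fun_fubini_tonelli_G _ mgap gap_ge0).
    - by move=> r _; apply: integral_ge0 => t _; exact: (gap_ge0 (t, r)).
    apply: eq_integral => r _.
    rewrite [X in _ = _ * X](ge0_integral_affine (- offset 0 r) (ltr0Sn _ 3))//.
    - rewrite muleA -EFinM mulVf// mul1e preimage_setT.
      apply: eq_integral => s _; rewrite /= offset0 offset1 /gap.
      by congr ((F _ * F _)%:E); ring.
    - exact: (measurableT_comp mgap (pair2_measurable r)).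
    - by move=> t; exact: (gap_ge0 (t, r)).
  rewrite -(fubini_tonelli _ mgap gap_ge0).
  apply: (@le_trans _ _ (4^-1%:E *
      \int[mu]_t ((F t)%:E * ((3 * pi)^-1%:E * mass F)))).
    rewrite ge0_integralZr//; last 3 first.
    - exact: measurable_profile.
    - by move=> s _; rewrite lee_fin.
    - by rewrite mule_ge0// lee_fin invr_ge0 mulr_ge0// pi_ge0.
    rewrite -/(mass F) [X in _ <= _ * X]muleCA [leRHS]muleA -EFinM.
    rewrite (_ : 4^-1 * (3 * pi)^-1 = (12 * pi)^-1)%R//.
    by have := pi_gt0 R; move: (@pi R) => p p0; field; exact: lt0r_neq0.
  rewrite lee_pmul2l// ?lte_fin//.
  apply: ge0_le_integral => //.
  - move=> t _; rewrite !mule_ge0// lee_fin//.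
    by rewrite invr_ge0 mulr_ge0// pi_ge0.
  - by apply: emeasurable_funM => //; exact: measurable_profile.
  - exact: (measurable_fun_fubini_tonelli_F _ mgap gap_ge0).
  move=> t _.
  rewrite [leRHS](_ : _ = (F t)%:E * \int[U]_r (F (t + gap r))%:E); last first.
    rewrite -ge0_integralZl//.
    - apply/measurable_EFinP; apply: measurable_F.
      apply: (@measurable_funD _ _ _ _ (cst t)) => //.
      by apply: continuous_measurable_fun; exact: continuous_gap.
    - by move=> r _; rewrite lee_fin.
    - by rewrite lee_fin.
  (* [mass_le_mean_gap] covers [t] within 3/2 of 0; elsewhere [F t] vanishes and so do both
     sides. *)
  have [t32|t32] := leP `|t|%R (3 / 2)%R.
    apply: lee_pmul => //; [by rewrite lee_fin| |exact: mass_le_mean_gap].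
    by rewrite mule_ge0// lee_fin invr_ge0 mulr_ge0// pi_ge0.
  by rewrite (_ : F t = 0%R) ?mul0e//; apply: F0; exact: ltW.
apply: le_trans (leeD2l _ ccE) _.
have mcc1 := measurable_fun_fubini_tonelli_F (m2 := U) _ mcc cc_ge0.
have msum1 := measurable_fun_fubini_tonelli_F (m2 := U) _ msum sum_ge0.
have pr := next_bound_profile pF.
rewrite -ge0_integralD//; last 3 first.
- by move=> s _; rewrite lee_fin; have [_ /(_ s) /andP[]] := pr.
- exact: measurable_profile.
- by move=> s _; apply: integral_ge0 => r _; exact: (cc_ge0 (s, r)).
rewrite -sumE; apply: ge0_le_integral => //.
- move=> s _; apply: adde_ge0.
    by rewrite lee_fin; have [_ /(_ s) /andP[]] := pr.
  by apply: integral_ge0 => r _; exact: (cc_ge0 (s, r)).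
- by apply: emeasurable_funD => //; exact: measurable_profile.
- by move=> s _; exact: next_bound_child_le.
Qed.

End mass_recursion.

(** * Decay of the total mass *)

Section decay.
Context (R : realType).
Local Notation mu := (@lebesgue_measure R).

Definition hit_bound m : R -> R := iter m (@next_bound R) (@tent R).

Lemma hit_bound_profile m : profile (hit_bound m).
Proof. by elim: m => [|m IH]; [exact: tent_profile|exact: next_bound_profile]. Qed.

Lemma mass_ge0 (F : R -> R) : profile F -> (0 <= mass F)%E.
Proof.
by move=> [_ F01 _]; apply: integral_ge0 => s _; rewrite lee_fin; have /andP[] := F01 s.
Qed.

Lemma mass_lty (F : R -> R) : profile F -> (mass F < +oo)%E.
Proof.
move=> pF; have [_ F01 F0] := pF.
apply: (@le_lt_trans _ _ (\int[mu]_(s in `[(- (3 / 2))%R, (3 / 2)%R]) 1)%E).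
  rewrite integral_mkcond; apply: ge0_le_integral => //.
  - by move=> s _; rewrite lee_fin; have /andP[] := F01 s.
  - exact: measurable_profile.
  - by apply/(measurable_restrictT _ _).1 => //.
  - move=> s _; rewrite patchE; case: ifPn => [_|].
      by rewrite lee_fin; have /andP[] := F01 s.
    rewrite notin_setE /= in_itv /= -ler_norml => /negP; rewrite -ltNge => s32.
    by rewrite F0// ltW.
by rewrite integral_cst//= mul1e lebesgue_measure_itv /=; case: ifP => _; exact: ltry.
Qed.

(** With [x = q * u m] and [y = q * u m.+1], the hypothesis reads [y <= x - x ^+ 2], whence
    [y * (1 + x) <= x]. For positive values this says that the inverse grows by at least 1 at each
    step. *)
Lemma quadratic_decay (u : R^nat) (q : R) : 0 <= q ->
  (forall m, 0 <= u m) -> (forall m, u m.+1 + q * u m ^+ 2 <= u m) ->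
  forall m, m%:R * (q * u m) <= 1.
Proof.
move=> q0 u0 urec; elim=> [|m IH]; first by rewrite mul0r.
have {}urec : q * u m.+1 + (q * u m) ^+ 2 <= q * u m.
  rewrite (_ : _ + _ = q * (u m.+1 + q * u m ^+ 2)); last by ring.
  by rewrite ler_wpM2l.
have x0 : 0 <= q * u m by rewrite mulr_ge0.
have y0 : 0 <= q * u m.+1 by rewrite mulr_ge0.
move: (q * u m) (q * u m.+1) x0 y0 urec IH => x y x0 y0 xy mx.
have m0 : 0 <= m%:R :> R by exact: ler0n.
rewrite -natr1; set M : R := m%:R in mx m0 *.
have h : y * (1 + x) <= x.
  apply: (@le_trans _ _ ((x - x ^+ 2) * (1 + x))); first by rewrite ler_wpM2r//; lra.
  have : 0 <= x ^+ 3 by rewrite exprn_ge0.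
  lra.
rewrite -(@ler_pM2r _ (1 + x)); last by lra.
rewrite mul1r -mulrA; apply: (@le_trans _ _ ((M + 1) * x)); last by lra.
by rewrite ler_wpM2l//; lra.
Qed.

Lemma mass_hit_bound n : (0 < n)%N ->
  (mass (hit_bound n) <= (12 * pi / n%:R)%:E)%E.
Proof.
move=> n0; pose u m := fine (mass (hit_bound m)).
have uE m : mass (hit_bound m) = (u m)%:E.
  by rewrite fineK// ge0_fin_numE ?mass_ge0 ?mass_lty//; exact: hit_bound_profile.
have pi0 := pi_gt0 R.
have q0 : 0 < 12 * pi :> R by rewrite mulr_gt0.
have := @quadratic_decay u (12 * pi)^-1.
move=> /(_ _ _ _ n) h; rewrite uE lee_fin ler_pdivlMr ?ltr0n//.
rewrite mulrC -[leRHS]mulr1 -ler_pdivrMl// mulrCA; apply: h.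
- by rewrite invr_ge0 ltW.
- by move=> m; rewrite fine_ge0// mass_ge0//; exact: hit_bound_profile.
- by move=> m; rewrite -lee_fin EFinD EFinM expr2 EFinM -!uE; exact: mass_next_bound (hit_bound_profile m).
Qed.

End decay.

(** * Expected length of the projection *)

Section expectation.
Context (R : realType) (d : measure_display) (T : measurableType d)
  (P : probability T R) (omega : nat -> nat -> {RV P >-> R}).
Context (omega_indep : mutually_independent [set v | tree_vertex v]
    (fun v : nat * nat => omega v.1 v.2))
  (omega_unif : forall k j : nat, tree_vertex (k, j) ->
    forall A : set R, measurable A ->
    distribution P (omega k j) A = uniform_prob (pi2_gt0 R) A).

Local Notation mu := (@lebesgue_measure R).
Local Notation U := (uniform_prob (pi2_gt0 R)).
Local Open Scope ereal_scope.

Let w x : nat -> nat -> R := fun k j => omega k j x.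

Lemma measurable_missed theta m k j s : measurable (missed omega theta m k j s).
Proof.
exact: (sigma_cylinder_measurable (@missed_cylinder _ _ _ _ omega theta m k j s)).
Qed.

(** Induction on [m] over all subtrees. In [missed_rec] the four child probabilities are bounded
    below by the factors of [branch] at [r + theta]; [integral_branch_rotate] then removes
    [theta]. *)
Lemma missed_ge theta m k j s : (0 <= theta <= pi)%R -> (j < 4 ^ k)%N ->
  (1 - hit_bound m s)%:E <= P (missed omega theta m k j s).
Proof.
move=> tpi; elim: m k j s => [|m IH] k j s jk.
  (* Within [-1, 1] the claimed lower bound is 0; outside, the point is surely missed. *)
  have [s1|s1] := leP `|s|%R 1%R; first by rewrite /= tent1// subrr.
  rewrite (_ : missed _ _ _ _ _ _ = setT) ?probability_setT.
    by rewrite lee_fin gerBl; have [_ /(_ s) /andP[]] := tent_profile R.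
  by apply/seteqP; split => // x _ /=; apply/negP; rewrite -ltNge.
have [mp ->] := missed_rec omega_indep omega_unif theta m s jk.
have pF := hit_bound_profile R m.
rewrite -(integral_branch_rotate s pF tpi).
have b01 r := branch_ge0_le1 s (r + theta)%R pF.
apply: ge0_le_integral => //.
- by move=> r _; rewrite lee_fin; have /andP[] := b01 r.
- have [mb _] := integrableP _ _ _ (branch_integrable s pF).
  by apply: (measurableT_comp mb); exact: (@measurable_funD _ _ _ _ id (cst theta)).
- move=> r _; rewrite /branch.
  under [leRHS]eq_bigr => a _ do
    rewrite -(fineK (fin_num_measure P _ (measurable_missed _ _ _ _ _))).
  rewrite prodEFin lee_fin; apply: ler_prod => a _.
  set s' := (4 * s - _)%R; have [_ /(_ s') /andP[_ F1] _] := pF.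
  rewrite subr_ge0 F1 /= -lee_fin fineK.
    by apply: IH; rewrite expnS; have := ltn_ord a; lia.
  by rewrite fin_num_measure//; exact: measurable_missed.
Qed.

Definition shadow_length n (x : T) (theta : R) : \bar R :=
  mu (shadow (w x) theta n 0 0).

Lemma measurable_omega (d' : measure_display) (S : measurableType d')
    (f : S -> T) v : measurable_fun setT f ->
  measurable_fun setT (fun y => omega v.1 v.2 (f y)).
Proof. by move=> mf; exact: (measurableT_comp _ mf). Qed.

Lemma measurable_shadow_length n :
  measurable_fun setT
    (fun p : T * measurableTypeR R => shadow_length n p.1 p.2).
Proof.
pose G : set ((T * measurableTypeR R) * measurableTypeR R) :=
  [set y | shadow (w y.1.1) y.1.2 n 0 0 y.2].
have mG : measurable G.
  apply: (@measurable_shadow _ _ _ (fun p q y => omega p q y.1.1)) => // [v _|].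
    by apply: measurable_omega; exact: (measurableT_comp _ measurable_fst).
  exact: (measurableT_comp _ measurable_fst).
rewrite (_ : (fun _ => _) = mu \o xsection G); first exact: measurable_fun_xsection.
apply/funext => p; rewrite /shadow_length /=; congr (mu _).
by apply/seteqP; split => s /=; rewrite /xsection /= inE.
Qed.

Lemma shadow_length_ge0 n x theta : 0 <= shadow_length n x theta.
Proof. exact: measure_ge0. Qed.

(** By Tonelli the expected length is the integral over [s] of the probability that [s] is hit,
    which [hit_bound n] dominates. *)
Lemma expectation_shadow_length n theta : (0 <= theta <= pi)%R -> (0 < n)%N ->
  \int[P]_x shadow_length n x theta <= (12 * pi / n%:R)%:E.
Proof.
move=> tpi n0; apply: le_trans (mass_hit_bound R n0).
pose G : set (T * measurableTypeR R) := [set y | shadow (w y.1) theta n 0 0 y.2].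
have mG : measurable G.
  apply: (@measurable_shadow _ _ _ (fun p q y => omega p q y.1) (cst theta)) => // v _.
  exact: measurable_omega.
have mI : measurable_fun setT (fun p => (\1_G p : R)%:E).
  exact/measurable_EFinP/measurable_indic.
have I0 p : 0 <= (\1_G p : R)%:E by rewrite lee_fin.
rewrite (_ : \int[P]_x _ = \int[P]_x \int[mu]_s (\1_G (x, s) : R)%:E).
  rewrite (fubini_tonelli _ mI I0); apply: ge0_le_integral => //.
  - by move=> s _; apply: integral_ge0.
  - exact: (measurable_fun_fubini_tonelli_G _ mI I0).
  - by apply: measurable_profile; exact: hit_bound_profile.
  - move=> s _; have := @missed_ge theta n 0 0 s tpi (isT : (0 < 4 ^ 0)%N).
    rewrite (_ : \int[P]_x _ = P (~` missed omega theta n 0 0 s)); last first.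
      rewrite (_ : (fun x => _) = EFin \o (\1_(~` missed omega theta n 0 0 s) : T -> R)).
        by rewrite integral_indic ?setIT//; apply: measurableC; exact: measurable_missed.
      apply/funext => x; rewrite /= !indicE; congr ((nat_of_bool _)%:R%:E).
      by apply/idP/idP; rewrite !inE /G /=; [move=> h; apply|exact: contrapT].
    rewrite probability_setC; last exact: measurable_missed.
    rewrite EFinB leeBlDl// => h; rewrite leeBlDr//.
    by rewrite fin_num_measure//; exact: measurable_missed.
apply: eq_integral => x _; rewrite /shadow_length.
have msx : measurable (shadow (w x) theta n 0 0).
  by have := measurable_xsection x mG; congr (measurable _); apply/seteqP; split => s /=; rewrite /xsection /= inE.
rewrite -[X in mu X]setIT -integral_indic//; apply: eq_integral => s _.
Qed.

End expectation.

(** * Favard length *)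

Section favard.
Context (R : realType) (d : measure_display) (T : measurableType d)
  (P : probability T R) (omega : nat -> nat -> {RV P >-> R}).
Local Notation mu := (@lebesgue_measure R).
Local Open Scope ereal_scope.

Definition favard_length n (x : T) : \bar R :=
  Fav (disks (fun k j => omega k j x) n).

(** Extension by zero outside [0, pi] lets Tonelli be applied on the full product space. *)
Let ell n : T * measurableTypeR R -> \bar R :=
  fun p => ((shadow_length omega n p.1) \_ `[0%R, pi]) p.2.

Let ell_ge0 n p : 0 <= ell n p.
Proof. by apply: erestrict_ge0 => theta _; exact: shadow_length_ge0. Qed.

Let measurable_ell n : measurable_fun setT (ell n).
Proof.
rewrite (_ : ell n = fun p => shadow_length omega n p.1 p.2 *
    (\1_(`[0%R, pi] : set R) p.2 : R)%:E); last first.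
  by apply/funext => p; rewrite /ell epatch_indic.
apply: emeasurable_funM; first exact: measurable_shadow_length.
apply/measurable_EFinP.
have mI : measurable_fun (setT : set (measurableTypeR R)) (\1_(`[0%R, pi] : set R) : R -> R).
  exact: measurable_indic.
exact: (measurableT_comp mI measurable_snd).
Qed.

Lemma favard_lengthE n x :
  favard_length n x = pi^-1%:E * \int[mu]_theta ell n (x, theta).
Proof.
rewrite /favard_length /Fav integral_mkcond; congr (_ * _).
apply: eq_integral => theta _; rewrite /ell /=; congr (patch _ _ _ _).
by apply/funext => t; rewrite line_measure_disks.
Qed.

Lemma favard_length_ge0 n x : 0 <= favard_length n x.
Proof.
rewrite favard_lengthE mule_ge0// ?lee_fin ?invr_ge0 ?pi_ge0//.
by apply: integral_ge0 => theta _; exact: ell_ge0.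
Qed.

Lemma measurable_favard_length n : measurable_fun setT (favard_length n).
Proof.
rewrite (_ : favard_length n = fun x => pi^-1%:E * \int[mu]_theta ell n (x, theta)).
  apply: measurable_funeM.
  exact: (measurable_fun_fubini_tonelli_F _ (measurable_ell n) (ell_ge0 n)).
by apply/funext => x; exact: favard_lengthE.
Qed.

(** Exchange expectation and the integral over directions; the length [pi] of the range cancels the
    normalisation. *)
Lemma expectation_favard_length n (c : R) : (0 <= c)%R ->
  (forall theta : R, (0 <= theta <= pi)%R ->
    \int[P]_x shadow_length omega n x theta <= c%:E) ->
  \int[P]_x favard_length n x <= c%:E.
Proof.
move=> c0 h; have pi0 := pi_gt0 R.
under eq_integral do rewrite favard_lengthE.
rewrite ge0_integralZl//; last 3 first.
- exact: (measurable_fun_fubini_tonelli_F _ (measurable_ell n) (ell_ge0 n)).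
- by move=> x _; apply: integral_ge0 => theta _; exact: ell_ge0.
- by rewrite lee_fin invr_ge0 ltW.
rewrite (fubini_tonelli _ (measurable_ell n) (ell_ge0 n)).
apply: (@le_trans _ _ (pi^-1%:E * \int[mu]_(theta in `[0%R, pi]) c%:E)).
  rewrite lee_pmul2l ?lte_fin ?invr_gt0// [leRHS]integral_mkcond.
  apply: ge0_le_integral => //.
  - by move=> theta _; apply: integral_ge0 => x _; exact: ell_ge0.
  - exact: (measurable_fun_fubini_tonelli_G _ (measurable_ell n) (ell_ge0 n)).
  - exact/(measurable_restrictT _ _).1.
  - move=> theta _; rewrite /ell /= patchE; case: ifPn => tpi.
      under eq_integral do rewrite patchE tpi.
      by apply: h; move: tpi; rewrite inE /= in_itv.
    under eq_integral do rewrite patchE (negbTE tpi).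
    by rewrite integral0.
rewrite integral_cst//= lebesgue_measure_itv /= lte_fin pi0 -EFinD -!EFinM.
by rewrite lee_fin subr0 mulrCA mulVf ?mulr1// gt_eqF.
Qed.

End favard.

(** By Fatou, the integral of the lower limit is at most [c], and an integrable function is finite
    almost everywhere. *)
Lemma ae_liminf_lty (d : measure_display) (T : measurableType d) (R : realType)
    (mu : {measure set T -> \bar R}) (f : (T -> \bar R)^nat) (c : R) :
  (forall n, measurable_fun setT (f n)) -> (forall n x, (0 <= f n x)%E) ->
  (forall n, (\int[mu]_x f n x <= c%:E)%E) ->
  {ae mu, forall x, (limn_einf (f ^~ x) < +oo)%E}.
Proof.
move=> mf f0 fc.
have g0 x : (0 <= limn_einf (f ^~ x))%E.
  rewrite limn_einf_lim; apply: lime_ge; first exact: is_cvg_einfs.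
  by apply: nearW => n; apply: le_ereal_inf_tmp => _ [k _ <-].
have mg : measurable_fun setT (fun x => limn_einf (f ^~ x)).
  rewrite (_ : (fun x => _) = (fun x => - limn_esup (fun n => - f n x))%E)//.
  apply: measurableT_comp => //.
  by apply: measurable_fun_limn_esup => n; exact: measurableT_comp.
have ig : (\int[mu]_x limn_einf (f ^~ x) <= c%:E)%E.
  apply: le_trans (fatou _ _ _ _) _ => //.
  rewrite limn_einf_lim; apply: lime_le; first exact: is_cvg_einfs.
  apply: nearW => n; apply: le_trans (fc n).
  by apply: ereal_inf_lbound; exists n => /=.
have : mu.-integrable setT (fun x => limn_einf (f ^~ x)).
  apply/integrableP; split => //.
  under eq_integral do rewrite gee0_abs//.
  exact: le_lt_trans ig (ltry _).
move=> /integrable_ae => /(_ measurableT); apply: filterS => x /(_ I).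
by rewrite ge0_fin_numE.
Qed.

Theorem theorem1 (R : realType) (d : measure_display) (T : measurableType d)
    (P : probability T R) (omega : nat -> nat -> {RV P >-> R})
    (omega_indep : mutually_independent [set v | tree_vertex v]
                     (fun v : nat * nat => omega v.1 v.2))
    (omega_unif : forall k j : nat, tree_vertex (k, j) ->
       forall A : set R, measurable A ->
       distribution P (omega k j) A = uniform_prob (pi2_gt0 R) A) :
  let D (n : nat) (x : T) := disks (fun k j => omega k j x) n in
  exists c : R, [/\ 0 < c,
    forall theta : R, 0 <= theta <= pi / 2 -> forall n : nat, (1 <= n)%N ->
      (\int[P]_x line_measure theta (orth_proj theta (D n x)) <= (c / n%:R)%:E)%E,
    forall n : nat, (1 <= n)%N ->
      (\int[P]_x Fav (D n x) <= (c / n%:R)%:E)%E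
  & {ae P, forall x, (limn_einf (fun n => n%:R%:E * Fav (D n x)) < +oo)%E}].
Proof.
move=> D; have pi0 := pi_gt0 R.
have c0 : 0 < 12 * pi :> R by rewrite mulr_gt0.
(* The range [0, pi] is what the Favard length integrates over; it contains the directions of the
   first claim. *)
have length_le n theta : 0 <= theta <= pi -> (1 <= n)%N ->
    (\int[P]_x shadow_length omega n x theta <= (12 * pi / n%:R)%:E)%E.
  exact: expectation_shadow_length.
have Fav_le n : (1 <= n)%N -> (\int[P]_x favard_length omega n x <= (12 * pi / n%:R)%:E)%E.
  move=> n1; apply: expectation_favard_length => [|theta tpi].
    by rewrite divr_ge0// ltW.
  exact: length_le.
exists (12 * pi); split => //.
- move=> theta /andP[t0 tpi2] n n1.
  rewrite (eq_integral (fun x => shadow_length omega n x theta)).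
    by apply: length_le => //; apply/andP; split; lra.
  by move=> x _; rewrite line_measure_disks.
- apply: (@ae_liminf_lty _ _ _ P (fun n x => n%:R%:E * favard_length omega n x)%E (12 * pi)).
  + by move=> n; apply: measurable_funeM; exact: measurable_favard_length.
  + by move=> n x; rewrite mule_ge0 ?lee_fin// favard_length_ge0.
  + move=> n; rewrite ge0_integralZl//; last 2 first.
    * exact: measurable_favard_length.
    * by move=> x _; exact: favard_length_ge0.
    (* The sequence starts at 0, where the factor [n] kills the term; for positive [n] it cancels
       the denominator. *)
    have [->|n0] := posnP n; first by rewrite mul0e lee_fin ltW.
    apply: (@le_trans _ _ (n%:R%:E * (12 * pi / n%:R)%:E)%E).
      by rewrite lee_pmul2l ?lte_fin ?ltr0n// Fav_le.
    by rewrite -EFinM lee_fin mulrC divfK// pnatr_eq0 -lt0n.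
Qed.
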